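(* (a) Let $E$ be a locally convex space such that $(E,w)$ is Eberlein-Grothendieck. If there is a linear continuous quotient mapping $\pi$ from $E$ onto a locally convex space $F$, then $(F,w)$ is also Eberlein-Grothendieck. (b) Let $E$ be a locally convex space such that $(E,w)$ is Eberlein-Grothendieck. Then $(F,w)$ is Eberlein-Grothendieck for every linear subspace $F\subset E$. (c) Let $E_n$, $n\in\omega$, be locally convex spaces such that each $(E_n,w)$ is Eberlein-Grothendieck. Then the countable product $E=\prod_{n\in\omega}E_n$ also has the property that $(E,w)$ is Eberlein-Grothendieck.
   Context: All topological spaces are assumed to be Tychonoff (in particular locally convex spaces are Hausdorff) and all vector spaces are over $\mathbb{R}$. For a locally convex space $E$, $(E,w)$ denotes $E$ with its weak topology $w=\sigma(E,E^{\ast})$, where $E^{\ast}$ is the space of continuous linear functionals on $E$; a linear subspace $F\subset E$ carries the subspace topology, and $(F,w)$ is $F$ with its own weak topology $\sigma(F,F^{\ast})$. $C_p(K)$ is the space of continuous real-valued functions on $K$ with the topology of pointwise convergence. A topological space $Y$ is Eberlein-Grothendieck if there is a homeomorphic embedding of $Y$ into $C_p(K)$ for some compact space $K$. A linear continuous quotient mapping is a continuous open linear surjection. *)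

(* Defs.v *)
From HB Require Import structures.
From mathcomp Require Import all_boot all_order all_algebra.
From mathcomp Require Import all_classical all_reals all_analysis.

Set Implicit Arguments.
Unset Strict Implicit.
Unset Printing Implicit Defensive.

Import Order.TTheory GRing.Theory Num.Theory.
Import numFieldNormedType.Exports.

Local Open Scope classical_set_scope.
Local Open Scope ring_scope.

(** A locally convex space is a [tvsType R] (whose topology has a basis of
    convex sets) that is moreover a [hausdorff_space]. *)

(** A vector space whose topology is initial (hypothesis [initialP]) for a
    family of linear maps to locally convex spaces is a [tvsType]. *)
Section initial_tvs.
Context {R : realType} {I : Type} {E : I -> tvsType R}.
Context {V : preTopologicalLmodType R} (f : forall i, {linear V -> E i}).
Hypothesis initialP : forall (F : set_system V) (x : V), Filter F ->
  F --> x <-> forall i, f i @ F --> f i x.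

Lemma initial_map_continuous i : continuous (f i).
Proof. by move=> x; apply: (initialP x _).1; exact: cvg_id. Qed.

Lemma initial_add_continuous : continuous (fun x : V * V => x.1 + x.2).
Proof.
move=> [x y]; apply/initialP => i /=; rewrite linearD.
have fD : f i \o (fun z : V * V => z.1 + z.2) = fun z => f i z.1 + f i z.2.
  by apply/funext => z /=; rewrite linearD.
rewrite -[X in X --> _]/((f i \o (fun z : V * V => z.1 + z.2)) @ (x, y)) fD.
apply: (@cvg_comp _ _ _ (fun z : V * V => (f i z.1, f i z.2))
  (fun z : E i * E i => z.1 + z.2)); last exact: (@add_continuous (E i) (_, _)).
apply: cvg_pair => /=.
- by apply: (@cvg_comp _ _ _ fst (f i));
    [exact: cvg_fst|exact: initial_map_continuous].
- by apply: (@cvg_comp _ _ _ snd (f i));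
    [exact: cvg_snd|exact: initial_map_continuous].
Qed.

Lemma initial_scale_continuous : continuous (fun z : R^o * V => z.1 *: z.2).
Proof.
move=> [k x]; apply/initialP => i /=; rewrite linearZ.
have fZ : f i \o (fun z : R^o * V => z.1 *: z.2) = fun z => z.1 *: f i z.2.
  by apply/funext => z /=; rewrite linearZ.
rewrite -[X in X --> _]/((f i \o (fun z : R^o * V => z.1 *: z.2)) @ (k, x)) fZ.
apply: (@cvg_comp _ _ _ (fun z : R^o * V => (z.1, f i z.2))
  (fun z : R^o * E i => z.1 *: z.2));
  last exact: (@scale_continuous R (E i) (_, _)).
apply: (@cvg_pair _ _ _ _ (nbhs (k : R^o))) => /=; first exact: cvg_fst.
by apply: (@cvg_comp _ _ _ snd (f i));
    [exact: cvg_snd|exact: initial_map_continuous].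
Qed.

Lemma initial_locally_convex :
  exists2 B : set_system V, (forall b, b \in B -> convex_set b) & basis B.
Proof.
exists [set b | open b /\ convex_set b]; first by move=> b /set_mem[].
split=> [b []//|x]; apply/initialP.
  apply: filter_from_filter.
    by exists setT; split=> //; split; [exact: openT|move=> *; rewrite inE].
  move=> b c [[ob cb] bx] [[oc cc] cx]; exists (b `&` c) => //.
  split=> //; split; first exact: openI.
  move=> y z l /set_mem[by_ cy] /set_mem[bz cz]; apply/mem_set; split.
    by apply/set_mem/cb; exact/mem_set.
  by apply/set_mem/cc; exact/mem_set.
move=> i A nA; have [B cB [oB /(_ _ _ nA)[b [Bb bfx] bA]]] :=
  @locally_convex R (E i).
exists (f i @^-1` b); last by move=> y; exact: bA.
split=> //; split.
  by apply: open_comp => [y _|]; [exact: initial_map_continuous|exact: oB].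
move=> y z l /set_mem by_ /set_mem bz; apply/mem_set => /=.
rewrite linearD !linearZ; apply/set_mem/cB; exact/mem_set.
Qed.

End initial_tvs.

(** [submodClosed E] is MathComp's type of (classically, all) linear subspaces
    of [E]; [weak_space (linear_subspace F)] is then sigma(F, F^* ) for the dual
    of [F] itself, not the topology induced by sigma(E, E^* ). *)
Definition linear_subspace (R : realType) (E : tvsType R)
  (F : submodClosed E) : Type := {x : E | x \in F}.

Section linear_subspace.
Context {R : realType} {E : tvsType R} (F : submodClosed E).
Local Notation V := (linear_subspace F).

HB.instance Definition _ := [isSub of V for @sval E (fun x => x \in F)].
HB.instance Definition _ := [Choice of V by <:].
HB.instance Definition _ := [SubChoice_isSubLmodule of V by <:].
HB.instance Definition _ := Uniform.copy V (initial_topology (\val : V -> E)).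

Let val_linear (_ : unit) : {linear V -> E} := \val.

Let val_initialP (G : set_system V) (x : V) : Filter G ->
  G --> x <-> forall i, val_linear i @ G --> val_linear i x.
Proof.
move=> FG; split=> [Gx []|/(_ tt) Gx].
  exact: cvg_comp Gx (@initial_continuous V E \val x).
move=> A [_ [[B oB <-] Bx] BA].
apply: (filterS BA); apply: Gx; exact: open_nbhs_nbhs.
Qed.

HB.instance Definition _ := PreTopologicalNmodule_isTopologicalNmodule.Build V
  (initial_add_continuous val_initialP).
HB.instance Definition _ := TopologicalNmodule_isTopologicalLmodule.Build R V
  (initial_scale_continuous val_initialP).
HB.instance Definition _ :=
  Uniform_isTvs.Build R V (initial_locally_convex val_initialP).

End linear_subspace.

Section prod_lmodule.
Context {R : realType} {I : Type} (E : I -> tvsType R).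
Local Notation V := (prod_topology E).

Let add (x y : V) : V := fun i => x i + y i.
Let opp (x : V) : V := fun i => - x i.
Let scale (k : R) (x : V) : V := fun i => k *: x i.

Let dfunext (x y : V) : (forall i, x i = y i) -> x = y.
Proof. exact: functional_extensionality_dep. Qed.

Let addA : associative add.
Proof. by move=> x y z; apply/dfunext => i; exact: addrA. Qed.
Let addC : commutative add.
Proof. by move=> x y; apply/dfunext => i; exact: addrC. Qed.
Let add0 : left_id ((fun=> 0) : V) add.
Proof. by move=> x; apply/dfunext => i; exact: add0r. Qed.
Let addN : left_inverse ((fun=> 0) : V) opp add.
Proof. by move=> x; apply/dfunext => i; exact: addNr. Qed.

HB.instance Definition _ := GRing.isZmodule.Build V addA addC add0 addN.

Let scaleA k l x : scale k (scale l x) = scale (k * l) x.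
Proof. by apply/dfunext => i; exact: scalerA. Qed.
Let scale1 : left_id 1 scale.
Proof. by move=> x; apply/dfunext => i; exact: scale1r. Qed.
Let scaleDr : right_distributive scale +%R.
Proof. by move=> k x y; apply/dfunext => i; exact: scalerDr. Qed.
Let scaleDl x : {morph scale^~ x : k l / k + l}.
Proof. by move=> k l; apply/dfunext => i; exact: scalerDl. Qed.

HB.instance Definition _ :=
  GRing.Zmodule_isLmodule.Build R V scaleA scale1 scaleDr scaleDl.

Definition prod_coord (i : I) (x : V) : E i := x i.

Let coord_linear i : linear (prod_coord i).
Proof. by []. Qed.

HB.instance Definition _ i :=
  GRing.isLinear.Build R V (E i) _ (prod_coord i) (coord_linear i).

Let coord (i : I) : {linear V -> E i} := prod_coord i.

Let coord_initialP (G : set_system V) (x : V) : Filter G ->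
  G --> x <-> forall i, coord i @ G --> coord i x.
Proof.
move=> FG; split=> [/cvg_sup Gx i A nA|Gx].
  have /(Gx i) : @nbhs _ (initial_topology (fun g : V => g i)) x
      (coord i @^-1` A).
    by apply: (@initial_continuous V (E i) (fun g => g i)).
  by [].
apply/cvg_sup => i A [_ [[B oB <-] Bx] BA].
apply: (filterS BA); apply: (Gx i); exact: open_nbhs_nbhs.
Qed.

HB.instance Definition _ := PreTopologicalNmodule_isTopologicalNmodule.Build V
  (initial_add_continuous coord_initialP).
HB.instance Definition _ := TopologicalNmodule_isTopologicalLmodule.Build R V
  (initial_scale_continuous coord_initialP).
HB.instance Definition _ :=
  Uniform_isTvs.Build R V (initial_locally_convex coord_initialP).

End prod_lmodule.

Section weak_topology.
Context {R : realType}.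

Definition topological_dual (E : tvsType R) : Type :=
  {f : {scalar E} | continuous (f : E -> R)}.

Definition weak_space (E : tvsType R) : Type := E.

HB.instance Definition _ (E : tvsType R) := Topological.copy (weak_space E)
  (sup_topology (fun f : topological_dual E =>
    Topological.class (initial_topology (sval f : E -> R)))).

End weak_topology.

Definition Cp (R : realType) (K : topologicalType) : Type := continuousType K R.

HB.instance Definition _ (R : realType) (K : topologicalType) :=
  Topological.copy (Cp R K)
    (initial_topology (id : continuousType K R -> {ptws K -> R})).

Definition embedding (X Y : topologicalType) (f : X -> Y) :=
  [/\ injective f, continuous f &
      forall U, open U -> exists2 V, open V & f @` U = range f `&` V].

(** Tychonoff spaces being Hausdorff, "compact" includes [hausdorff_space]. *)
Definition eberlein_grothendieck (R : realType) (Y : topologicalType) :=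
  exists K : topologicalType,
    [/\ hausdorff_space K, compact [set: K] &
        exists f : Y -> Cp R K, embedding f].

Definition linear_quotient_map (R : realType) (E F : tvsType R)
    (pi : {linear E -> F}) :=
  [/\ continuous pi, forall U, open U -> open (pi @` U) &
      range pi = [set: F]].

(* Main.v *)
From HB Require Import structures.
Require Import Defs.
From mathcomp Require Import all_boot all_order all_algebra.
From mathcomp Require Import all_classical all_reals all_analysis.
From mathcomp Require Import lra.

(** The idea is to read the property off the dual. For a locally convex space
    [E], the space (E, w) is Eberlein-Grothendieck exactly when the dual of [E],
    with the topology of pointwise convergence on [E], is a countable union of
    compact sets.

    From the property to the dual ([dual_sigma_compact]): let [f] embed (E, w)
    into C_p(K). Continuity of a functional [l] at 0 is witnessed by finitely
    many points of [K] and a tolerance, hence [l] is bounded by 1 on some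
    [slab m k], where [k] lists points of [K] of which the first [m] count. For
    fixed [m], the set [polar_union m] of all functionals so bounded, over all
    choices of [k], is compact. Along an ultrafilter on it the points [k] can be
    made to converge, because [K] is compact; the slab of the limit points is
    absorbing and bounds the functionals in the limit, so the functionals
    themselves converge pointwise.

    From the dual to the property ([eberlein_grothendieck_of_compacts]): let
    compact sets [A n] of continuous functions on a Hausdorff space [Y]
    determine its topology. Composing the functions of [A n] with a
    homeomorphism of the line onto the interval ]-1, 1[ and dividing by [n + 1]
    changes neither compactness nor the topology determined. The
    rescaled sets shrink uniformly to the zero function, so that together with
    it they form one compact set [K] of continuous functions, and evaluation
    embeds [Y] into C_p(K).

    The three permanence properties follow. The dual of a quotient [F] of [E]
    consists of the functionals [l] with [l \o pi] in the dual of [E], and the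
    preimage of a compact set under [l |-> l \o pi] is compact
    ([compact_precomp_preimage]). The functionals on a subspace are the
    restrictions of those on [E] ([dual_extension], a form of the Hahn-Banach
    theorem), and restriction preserves compactness. A continuous functional on
    a product depends on finitely many coordinates ([dual_prod_finite]), so the
    compact sets of functionals of the factors, composed with the coordinate
    maps, determine the weak topology of the product, and they are countably
    many when there are countably many factors.

    The criterion also needs weak topologies to be Hausdorff
    ([weak_space_hausdorff]), which is again the Hahn-Banach theorem. *)

Set Implicit Arguments.
Unset Strict Implicit.
Unset Printing Implicit Defensive.

Import Order.TTheory GRing.Theory Num.Theory.
Import numFieldNormedType.Exports.
Local Open Scope classical_set_scope.
Local Open Scope ring_scope.

(** * Convergence in initial, pointwise and embedded topologies *)

Lemma initial_cvgP (S : choiceType) (T : topologicalType) (f : S -> T)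
    (G : set_system S) (x : S) : Filter G ->
  G --> (x : initial_topology f) <-> f @ G --> f x.
Proof.
move=> FG; split=> [Gx|Gx].
  exact: cvg_comp Gx (@initial_continuous S T f x).
move=> A [_ [[B oB <-] Bx] BA].
by apply: (filterS BA); apply: Gx; exact: open_nbhs_nbhs.
Qed.

Lemma ptws_cvgP (R : realType) (Y : Type) (G : set_system {ptws Y -> R})
    (g : {ptws Y -> R}) : Filter G ->
  G --> g <-> forall y, (fun h : {ptws Y -> R} => h y) @ G --> g y.
Proof.
by move=> FG; split=> [/cvg_sup Gg y|Gg];
  [apply/initial_cvgP/(Gg y)|apply/cvg_sup => y; apply/initial_cvgP/Gg].
Qed.

Lemma ptws_eval_continuous (R : realType) (Y : Type) (y : Y) :
  continuous (fun g : {ptws Y -> R} => g y).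
Proof.
move=> g; have [gy _] := ptws_cvgP g (nbhs_filter g).
exact: gy y.
Qed.

Lemma ptws_continuous (R : realType) (X : topologicalType) (Y : Type)
    (h : X -> {ptws Y -> R}) :
  (forall y, continuous (fun x => h x y)) -> continuous h.
Proof.
move=> hc x; have [_ hx] := ptws_cvgP (h x) (fmap_filter h (nbhs_filter x)).
by apply: hx => y; exact: hc.
Qed.

Lemma ptws_comp_continuous (R : realType) (Y : Type) (phi : R -> R) :
  continuous phi ->
  continuous (fun g : {ptws Y -> R} => (fun y => phi (g y)) : {ptws Y -> R}).
Proof.
move=> phic; apply: ptws_continuous => y g.
exact: (@cvg_comp _ _ _ (fun h : {ptws Y -> R} => h y) phi _ _ _
  (@ptws_eval_continuous R Y y g) (phic (g y))).
Qed.

Lemma Cp_cvgP (R : realType) (K : topologicalType) (G : set_system (Cp R K))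
    (g : Cp R K) : Filter G ->
  G --> g <->
  forall k, (fun h : Cp R K => (h : continuousType K R) k) @ G -->
    (g : continuousType K R) k.
Proof.
move=> FG; split=> [Gg k|Gg].
  have := (initial_cvgP _ _ FG).1 Gg.
  by move=> /ptws_cvgP; apply.
by apply/initial_cvgP/ptws_cvgP.
Qed.

Section embedding_filters.
Context {X Y : topologicalType}.

Lemma embedding_cvg (f : X -> Y) (G : set_system X) (x : X) : Filter G ->
  embedding f -> f @ G --> f x -> G --> x.
Proof.
move=> FG [finj _ fop] Gfx A; rewrite nbhsE => -[U [oU Ux] UA].
have [V oV UV] := fop _ oU.
have Vfx : V (f x) by have [] : (range f `&` V) (f x) by rewrite -UV; exists x.
apply: (@filterS _ _ _ (f @^-1` V)); last exact/Gfx/open_nbhs_nbhs.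
move=> z Vfz; apply: UA.
have [u Uu /finj <- //] : (f @` U) (f z) by rewrite UV; split=> //; exists z.
Qed.

Lemma initial_embedding (f : X -> Y) : injective f -> continuous f ->
  (forall G x, Filter G -> f @ G --> f x -> G --> x) -> embedding f.
Proof.
move=> finj fcont fini; split=> // U oU.
pose V := \bigcup_(W in [set W | open W /\ f @^-1` W `<=` U]) W.
exists V; first by apply: bigcup_open => W [].
rewrite eqEsubset; split=> [_ [x Ux <-]|_ [[x _ <-] [W [_ WU] Wx]]]; last first.
  by exists x => //; exact: WU.
split; first by exists x.
pose G := filter_from (nbhs (f x)) (fun W => f @^-1` W).
have FG : Filter G.
  apply: filter_from_filter; first by exists setT; exact: filterT.
  by move=> A B nA nB; exists (A `&` B) => //; exact: filterI.
have [|W + WU] := fini G x FG _ U (open_nbhs_nbhs (conj oU Ux)).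
  by move=> W nW; exists W.
rewrite nbhsE => -[W' [oW' W'x] W'W]; exists W' => //; split=> //.
exact: subset_trans (preimage_subset W'W) WU.
Qed.

(** A cluster point [q] of the neighbourhoods of [p] is the limit of a filter
    finer than these, along which every continuous function tends both to its
    value at [p] and to its value at [q]. *)
Lemma hausdorff_separated (R : realType) :
  (forall p q : X, (forall f : X -> R, continuous f -> f p = f q) -> p = q) ->
  hausdorff_space X.
Proof.
move=> sepX p q; rewrite cluster_cvgE => -[G PG [Gq Gp]].
apply: sepX => f fcont; apply: (@cvg_unique _ (@Rhausdorff R) (f @ G)).
  exact: (cvg_comp _ _ Gp (fcont p)).
exact: (cvg_comp _ _ Gq (fcont q)).
Qed.

End embedding_filters.

(** A compact set catches the image of any ultrafilter that enters it: the
    image is again an ultrafilter, so a cluster point is a limit. Stating this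
    for a map rather than for a filter on [X] allows the several limits of one
    argument to be taken along the same ultrafilter. *)
Lemma ultra_map_cvg (T : Type) (X : topologicalType) (F : set_system T)
    (h : T -> X) (A : set X) :
  UltraFilter F -> compact A -> F (h @^-1` A) ->
  exists2 l, A l & h @ F --> l.
Proof.
move=> UF Ac FA; have [l [Al clFl]] := Ac (h @ F) _ FA; exists l => // B nB.
have [//|FB] := in_ultra_setVsetC (h @^-1` B) UF.
by have [z []] := clFl (~` B) B FB nB.
Qed.

Lemma filter_forall_lt (T : Type) (F : set_system T) (P : nat -> set T)
    (m : nat) : Filter F ->
  (forall i, (i < m)%N -> F (P i)) ->
  F [set x | forall i, (i < m)%N -> P i x].
Proof.
move=> FF; elim: m => [_|m IH FP]; first by apply: filterS filterT.
have FPm := IH (fun i im => FP i (ltnW im)).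
apply: filterS (filterI (FP m (ltnSn m)) FPm) => x [Pm Pi] i.
by rewrite ltnS leq_eqVlt => /predU1P[->//|]; exact: Pi.
Qed.

(** * Compact sets of functions that determine a topology *)

Section squash.
Context {R : realType}.

(** A homeomorphism of the line onto ]-1, 1[. *)
Definition squash (t : R) : R := t / (1 + `|t|).

Lemma norm_squash t : `|squash t| <= 1.
Proof.
rewrite normrM normfV (@ger0_norm _ (1 + _)) ?addr_ge0//.
by rewrite ler_pdivrMr ?ltr_pwDl// mul1r lerDr.
Qed.

Lemma squash_continuous : continuous squash.
Proof.
move=> t; apply: cvgM; first exact: cvg_id.
apply: cvgV; first by rewrite gt_eqF// ltr_pwDl.
by apply: cvgD; [exact: cvg_cst|exact: norm_continuous].
Qed.

(** The inverse homeomorphism is [u |-> u / (1 - `|u|)]. *)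
Lemma squash_cvg (T : Type) (G : set_system T) (h : T -> R) (t : R) :
  Filter G -> squash \o h @ G --> squash t -> h @ G --> t.
Proof.
move=> FG Gt; pose unsquash (u : R) : R := u / (1 - `|u|).
have squashK s : unsquash (squash s) = s.
  have s1 : 1 + `|s| != 0 by rewrite gt_eqF// ltr_pwDl.
  rewrite /unsquash /squash normrM normfV (@ger0_norm _ (1 + _)) ?addr_ge0//.
  have -> : 1 - `|s| / (1 + `|s|) = (1 + `|s|)^-1.
    by rewrite -[X in X - _](divff s1) -mulrBl addrK mul1r.
  by rewrite invrK mulfVK.
have hE : h = unsquash \o (squash \o h).
  by apply/funext => z /=; rewrite squashK.
rewrite hE -[X in _ --> X]squashK.
apply: (cvg_comp _ _ Gt); apply: cvgM; first exact: cvg_id.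
apply: cvgV.
  rewrite subr_eq0 eq_sym lt_eqF//.
  rewrite normrM normfV (@ger0_norm _ (1 + _)) ?addr_ge0//.
  by rewrite ltr_pdivrMr ?ltr_pwDl// mul1r ltrDr.
by apply: cvgB; [exact: cvg_cst|exact: norm_continuous].
Qed.

End squash.

(** An ultrafilter on this union either contains some [B n], and then converges
    in it, or leaves every [B n]; in the second case its members eventually lie
    in [B n] only for large [n], so it tends to 0. *)
Lemma null_union_compact (R : realType) (Y : Type)
    (B : nat -> set {ptws Y -> R}) :
  (forall n, compact (B n)) ->
  (forall n g y, B n g -> `|g y| <= n.+1%:R^-1) ->
  compact ([set (fun=> 0) : {ptws Y -> R}] `|` \bigcup_n B n).
Proof.
move=> Bc Bsmall; rewrite compact_ultra => F UF FK.
have [[n FB]|nFB] := pselect (exists n, F (B n)).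
  have := Bc n; rewrite compact_ultra => /(_ F UF FB)[g [Bg Fg]].
  by exists g; split=> //; right; exists n.
exists (fun=> 0); split; first by left.
apply/ptws_cvgP => y; apply/cvgrPdist_lt => e e0.
have FN N : F [set g | forall n, (n < N)%N -> ~ B n g].
  apply: (@filter_forall_lt _ F (fun n => ~` B n)) => n _.
  by have [FBn|//] := in_ultra_setVsetC (B n) UF; case: nFB; exists n.
have [N _ /(_ _ (leqnn N)) Ne] := near_infty_natSinv_lt (PosNum e0).
apply: filterS (filterI FK (FN N)) => g [[->|[n _ Bg]] gN].
  by rewrite /= subrr normr0.
rewrite /= sub0r normrN; apply: le_lt_trans (Bsmall _ _ _ Bg) _.
apply: le_lt_trans Ne; rewrite lef_pV2 ?posrE// ler_nat ltnS leqNgt.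
by apply/negP => /gN.
Qed.

(** The unbounded functions of [A n] are first squashed into ]-1, 1[ and then
    scaled by [1 / (n + 1)], which makes the union of the resulting sets compact
    once the zero function is added. Evaluation at the points of [Y] is the
    embedding; it is injective because a point all of whose evaluations agree
    with those of [y] is a limit of the same filters, and [Y] is Hausdorff. *)
Theorem eberlein_grothendieck_of_compacts (R : realType) (Y : topologicalType)
    (A : nat -> set {ptws Y -> R}) :
  hausdorff_space Y -> (forall n, compact (A n)) ->
  (forall n g, A n g -> continuous (g : Y -> R)) ->
  (forall (G : set_system Y) (y : Y), Filter G ->
    (forall n g, A n g -> g @ G --> g y) -> G --> y) ->
  eberlein_grothendieck R Y.
Proof.
move=> hY Ac Acont Agen.
pose phi n (t : R) : R := n.+1%:R^-1 * squash t.
have phic n : continuous (phi n).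
  move=> t; apply: cvgM; [exact: cvg_cst|exact: squash_continuous].
pose scale n (g : {ptws Y -> R}) : {ptws Y -> R} := fun y => phi n (g y).
pose K : set {ptws Y -> R} := [set (fun=> 0)] `|` \bigcup_n (scale n @` A n).
have Kc : compact K.
  apply: null_union_compact => n; last first.
    move=> _ y [g _ <-]; rewrite normrM ger0_norm ?invr_ge0//.
    by rewrite ler_piMr ?invr_ge0// norm_squash.
  have sc : continuous (scale n) := ptws_comp_continuous (phic n).
  exact: (continuous_compact (continuous_subspaceT sc) (Ac n)).
have Kcont g : K g -> continuous (g : Y -> R).
  case=> [->|[n _ [h Ah <-]]] y; first exact: cvg_cst.
  exact: (@cvg_comp _ _ _ h (phi n) _ _ _ (Acont n h Ah y) (phic n (h y))).
have evc (y : Y) : continuous (fun k : set_type K => set_val k y : R).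
  move=> k; exact: (@cvg_comp _ _ _ set_val (fun g : {ptws Y -> R} => g y) _ _ _
    (@initial_continuous _ _ set_val k)
    (@ptws_eval_continuous R Y y (set_val k))).
pose ev (y : Y) : Cp R (set_type K) :=
  mkcts (evc y) : continuousType (set_type K) R.
exists (set_type K); split.
- apply: (@hausdorff_separated _ R) => p q pq; apply/val_inj/funext => y.
  exact: (pq _ (evc y)).
- rewrite compact_ultra => F UF _.
  have [|g Kg Fg] := @ultra_map_cvg _ _ F set_val _ UF Kc.
    by apply: filterS filterT => z _; exact: set_valP.
  exists (SigSub (mem_set Kg)); split=> //.
  exact: (@initial_cvgP _ _ set_val F (SigSub (mem_set Kg)) _).2.
exists ev.
have evini G x : Filter G -> ev @ G --> ev x -> G --> x.
  move=> FG /Cp_cvgP Gx; apply: Agen => n g Ag.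
  have Kg : K (scale n g) by right; exists n => //; exists g.
  have {}Gx := Gx (SigSub (mem_set Kg)).
  apply: squash_cvg.
  have n0 : n.+1%:R != 0 :> R by rewrite pnatr_eq0.
  have cancel z : n.+1%:R * scale n g z = squash (g z) by rewrite mulVKf.
  have -> : squash \o g = fun z => n.+1%:R * scale n g z.
    by apply/funext => z; rewrite cancel.
  by rewrite -cancel; apply: cvgM; [exact: cvg_cst|exact: Gx].
apply: initial_embedding => //.
(* If [ev x = ev y], the principal filter of [x] converges to [y]. *)
- move=> x y xy; apply: hY => U V nU nV; exists x; split.
    exact: nbhs_singleton.
  have /evini : ev @ principal_filter x --> ev y.
    by rewrite -xy => W /nbhs_singleton Wx; exact/principal_filterP.
  by move=> /(_ V nV)/principal_filterP.
- by move=> y; apply/Cp_cvgP => k; apply: Kcont; exact: set_valP.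
Qed.

(** * The Hahn-Banach theorem *)

Lemma scalar_linear (R : realType) (V : lmodType R) (f : V -> R) :
  scalar f -> exists g : {scalar V}, f = g.
Proof.
move=> flin.
pose g : {scalar V} := HB.pack f (GRing.isLinear.Build R V R *%R f flin).
by exists g.
Qed.

Definition sublinear (R : realType) (V : lmodType R) (p : V -> R) :=
  (forall x y, p (x + y) <= p x + p y) /\
  (forall t x, 0 < t -> p (t *: x) <= t * p x).

Section hahn_banach.
Context {R : realType} {V : lmodType R}.
Implicit Types (p q : V -> R) (x y : V).

Lemma sublinear0 p : sublinear p -> p 0 = 0.
Proof.
move=> [_ pZ]; have := pZ 2 0 (ltr0n _ _); have := pZ 2^-1 0.
rewrite !scaler0 invr_gt0 ltr0n => /(_ isT); lra.
Qed.

Lemma sublinearN p x : sublinear p -> - p (- x) <= p x.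
Proof.
move=> sp; have := sp.1 x (- x); rewrite subrr sublinear0//; lra.
Qed.

Lemma sublinearZ p t x : sublinear p -> 0 <= t -> p (t *: x) = t * p x.
Proof.
move=> sp; rewrite le_eqVlt => /predU1P[<-|t0].
  by rewrite scale0r mul0r sublinear0.
apply/eqP; rewrite eq_le sp.2//= -ler_pdivlMl//.
have := sp.2 t^-1 (t *: x); rewrite scalerA mulVf ?gt_eqF// scale1r invr_gt0.
exact.
Qed.

(** The common form of the three constructions of sublinear functionals below:
    the infimum of a chain, the functional that tests a minimal one for
    additivity, and the gauge merged with a functional to extend. *)
Lemma sublinear_inf (S : V -> set R) :
  (forall x, has_inf (S x)) ->
  (forall x y a b, S x a -> S y b -> exists2 c, S (x + y) c & c <= a + b) ->
  (forall t x a, S x a -> 0 < t -> exists2 c, S (t *: x) c & c <= t * a) ->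
  sublinear (fun x => inf (S x)).
Proof.
move=> Sinf SD SZ.
have ge_infS x a : S x a -> inf (S x) <= a by exact: (ge_inf (Sinf x).2).
have le_infS c x : (forall a, S x a -> c <= a) -> c <= inf (S x).
  by apply: lb_le_inf; exact: (Sinf x).1.
split=> [x y|t x t0].
  rewrite -lerBlDl; apply/le_infS => b Sb; rewrite lerBlDl -lerBlDr.
  apply/le_infS => a Sa; rewrite lerBlDr.
  by have [c Sc] := SD _ _ _ _ Sa Sb; apply: le_trans; exact: ge_infS.
rewrite -ler_pdivrMl//; apply/le_infS => a Sa; rewrite ler_pdivrMl//.
by have [c Sc] := SZ _ _ _ Sa t0; apply: le_trans; exact: ge_infS.
Qed.

(** Zorn's lemma: the infimum of a chain of sublinear functionals below [p] is
    sublinear, and it is finite because all of them are at least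
    [x |-> - p (- x)]. *)
Lemma minimal_sublinear p : sublinear p ->
  exists q, [/\ sublinear q, forall x, q x <= p x &
    forall q', sublinear q' -> (forall x, q' x <= q x) -> q' = q].
Proof.
move=> sp; pose T := {q | sublinear q /\ forall x, q x <= p x}.
pose ge (s t : T) := `[< forall x, sval t x <= sval s x >].
have [||||[q [sq qp]] qmin] := @Zorn T ge.
- by move=> q; exact/asboolP.
- move=> r s t /asboolP rs /asboolP st; apply/asboolP => x.
  exact: le_trans (st x) (rs x).
- move=> s t /asboolP st /asboolP ts; apply: eq_sig_hprop;
    [by move=> ?; exact: Prop_irrelevance|apply/funext => x].
  by apply/eqP; rewrite eq_le st ts.
- move=> A Atot; have [A0|/set0P A0] := eqVneq A set0.
    exists (exist _ p (conj sp (fun x => lexx (p x)))) => s.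
    by rewrite A0.
  have Ap (i : T) x : - p (- x) <= sval i x.
    apply: le_trans _ (sublinearN x (svalP i).1).
    by rewrite lerN2; exact: (svalP i).2.
  have Ainf x : has_inf [set sval i x | i in A].
    split; first by have [i Ai] := A0; exists (sval i x), i.
    by exists (- p (- x)) => _ [i Ai <-].
  have qle i x : A i -> inf [set sval i x | i in A] <= sval i x.
    by move=> Ai; apply: (ge_inf (Ainf x).2); exists i.
  have sq : sublinear (fun x => inf [set sval i x | i in A]).
    apply: sublinear_inf => //.
      move=> x y _ _ [i Ai <-] [k Ak <-].
      have [/asboolP ik|/asboolP ki] := Atot _ _ Ai Ak.
        exists (sval k (x + y)); first by exists k.
        by apply: le_trans ((svalP k).1.1 x y) _; rewrite lerD2r.
      exists (sval i (x + y)); first by exists i.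
      by apply: le_trans ((svalP i).1.1 x y) _; rewrite lerD2l.
    move=> t x _ [i Ai <-] t0; exists (sval i (t *: x)); first by exists i.
    exact: (svalP i).1.2.
  have [s0 As0] := A0.
  have qp x : inf [set sval i x | i in A] <= p x.
    exact: le_trans (qle _ x As0) ((svalP s0).2 x).
  exists (exist _ (fun x => inf [set sval i x | i in A]) (conj sq qp)) => s As.
  by apply/asboolP => x; exact: qle.
exists q; split=> // q' sq' q'q.
have q'p x : q' x <= p x by exact: le_trans (q'q x) (qp x).
have := qmin (exist _ q' (conj sq' q'p)).
by move=> /(_ (asboolT q'q)) [].
Qed.

(** A minimal sublinear functional [q] is linear: for each [a], the functional
    [x |-> inf_(t >= 0) (q (x + t a) - t q a)] is sublinear and below [q], hence
    equal to [q]; its term at [t = 1] gives [q x + q a <= q (x + a)]. *)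
Theorem hahn_banach p : sublinear p ->
  exists2 L : V -> R, scalar L & forall x, L x <= p x.
Proof.
move=> /minimal_sublinear[q [sq qp qmin]].
have qDge x a : q x + q a <= q (x + a).
  pose S y := [set q (y + t *: a) - t * q a | t in [set t | 0 <= t]].
  have Sinf y : has_inf (S y).
    split; first by exists (q (y + 0 *: a) - 0 * q a); exists 0 => /=.
    exists (- q (- y)) => _ [t /= t0 <-].
    have := sq.1 (y + t *: a) (- y).
    by rewrite addrAC subrr add0r sublinearZ//; lra.
  have Sle t y : 0 <= t -> inf (S y) <= q (y + t *: a) - t * q a.
    by move=> t0; apply: (ge_inf (Sinf y).2); exists t.
  have SE : (fun y => inf (S y)) = q.
    apply: qmin => [|y]; last first.
      by have := Sle 0 y (lexx 0); rewrite scale0r addr0 mul0r subr0.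
    apply: sublinear_inf => // [y z _ _ [s /= s0 <-] [t /= t0 <-]|].
      exists (q (y + z + (s + t) *: a) - (s + t) * q a).
        by exists (s + t) => //=; exact: addr_ge0.
      have := sq.1 (y + s *: a) (z + t *: a).
      by rewrite addrACA -scalerDl mulrDl; lra.
    move=> t y _ [s /= s0 <-] t0.
    exists (q (t *: y + (t * s) *: a) - (t * s) * q a).
      by exists (t * s) => //=; rewrite mulr_ge0// ltW.
    have := sq.2 t (y + s *: a) t0.
    by rewrite scalerDr scalerA mulrBr mulrA; lra.
  have := Sle 1 x ler01; rewrite scale1r mul1r.
  by rewrite (congr1 (fun f => f x) SE); lra.
have qD x y : q (x + y) = q x + q y.
  by apply/eqP; rewrite eq_le sq.1 qDge.
have qN x : q (- x) = - q x.
  by apply/eqP; rewrite -addr_eq0 -qD addNr sublinear0.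
exists q => // t x y; rewrite qD; congr (_ + _).
have [t0|t0] := leP 0 t; first exact: sublinearZ.
by rewrite -[t]opprK scaleNr qN sublinearZ ?oppr_ge0 1?ltW// !mulNr.
Qed.

End hahn_banach.

Section continuous_extension.
Context {R : realType} {E : tvsType R}.

Lemma convex_set_conic (U : set E) (s t : R) (u v : E) :
  convex_set U -> 0 < s -> 0 < t -> U u -> U v ->
  exists2 w, U w & s *: u + t *: v = (s + t) *: w.
Proof.
move=> cU s0 t0 Uu Uv; have st0 : 0 < s + t by exact: addr_gt0.
have l0 : 0 <= s / (s + t) by rewrite divr_ge0// ltW.
have l1 : s / (s + t) <= 1 by rewrite ler_pdivrMr// mul1r lerDl ltW.
have := cU u v (Itv01 l0 l1) (mem_set Uu) (mem_set Uv).
set w := conv _ _ _ => /set_mem Uw; exists w => //.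
have e : (s + t) * (s / (s + t)) = s by rewrite mulrC divfK ?gt_eqF.
rewrite /w /conv/= scalerDr !scalerA mulrBr mulr1 e.
by rewrite addrAC subrr add0r.
Qed.

Lemma convex_nbhs0 (A : set E) : nbhs 0 A ->
  exists U, [/\ convex_set U, nbhs 0 U & U `<=` A].
Proof.
move=> nA; have [B cB [oB /(_ _ _ nA)[U [BU U0] UA]]] := @locally_convex R E.
exists U; split=> //; first exact/cB/mem_set.
by apply: open_nbhs_nbhs; split=> //; exact: oB.
Qed.

Lemma nbhs0_absorbing (U : set E) (x : E) : nbhs 0 U ->
  exists t, 0 < t /\ exists2 u, U u & x = t *: u.
Proof.
move=> nU; have xc : (fun k : R^o => k *: x) @ (0 : R^o) --> (0 : E).
  rewrite -[X in _ --> X](scale0r x).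
  apply: (@cvg_comp _ _ _ (fun k : R^o => (k, x))
    (fun z : R^o * E => z.1 *: z.2)); last first.
    exact: (@scale_continuous R E (_, _)).
  apply: (@cvg_pair _ _ _ _ (nbhs (0 : R^o))); first exact: cvg_id.
  exact: cvg_cst.
have [e /= e0 eU] := xc _ nU.
exists (2 / e); split; first by rewrite divr_gt0.
exists ((e / 2) *: x).
  apply: eU => /=; rewrite sub0r normrN gtr0_norm ?divr_gt0//.
  by rewrite ltr_pdivrMr// ltr_pMr// ltr1n.
by rewrite scalerA -invf_div mulVf ?scale1r// gt_eqF ?divr_gt0.
Qed.

(** A bound from above suffices: on the symmetric neighbourhood [U `&` - U] it
    bounds the absolute value. *)
Lemma scalar_bounded_continuous (L : E -> R) (U : set E) (c : R) : scalar L ->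
  nbhs 0 U -> (forall x, U x -> L x <= c) -> continuous L.
Proof.
move=> Llin nU Lc x; apply/cvgrPdist_lt => e e0.
have [l lE] := scalar_linear Llin; rewrite lE in Lc *.
pose C : R := `|c| + 1; have C0 : 0 < C by rewrite ltr_pwDr.
have r0 : e / (2 * C) != 0 by rewrite gt_eqF// divr_gt0// mulr_gt0.
have nV : nbhs 0 (U `&` (-%R @` U)) by apply: filterI => //; exact: nbhs0N.
apply: filterS (nbhsT x (nbhs0Z r0 nV)) => _ [_ [v [Uv [u Uu uv]] <-] <-].
rewrite linearD opprD addrA subrr add0r normrN linearZ /= normrM.
rewrite gtr0_norm ?divr_gt0 ?mulr_gt0//.
have : `|l v| < 2 * C.
  have := Lc _ Uv; have := Lc _ Uu; have := ler_norm c.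
  rewrite -uv linearN /C ltr_norml; lra.
by rewrite mulrAC ltr_pdivrMr ?mulr_gt0// ltr_pM2l.
Qed.

(** The functional [x |-> inf (t + l w)], over the decompositions
    [x = j w + t u] with [t > 0] and [u] in [U], is sublinear, at most 1 on [U]
    and at most [l] along [j]. It merges the Minkowski gauge of [U] with [l], so
    a linear functional below it is continuous and extends [l]. The subspace is
    given by a linear map [j] in order to apply the theorem both to the
    inclusion of a subspace and to the parametrization of a line. *)
Theorem hahn_banach_extension (W : lmodType R) (j : {linear W -> E})
    (l : W -> R) (U : set E) :
  scalar l -> convex_set U -> nbhs 0 U ->
  (forall w, U (j w) -> l w <= 1) ->
  exists L : E -> R, [/\ scalar L, continuous L & forall w, L (j w) = l w].
Proof.
move=> llin cU nU lU.
have [l' lE] := scalar_linear llin; rewrite {l llin}lE in lU *.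
pose S (x : E) : set R := [set a | exists t w u,
  [/\ 0 < t, U u, x = j w + t *: u & a = t + l' w]].
have Sinf x : has_inf (S x).
  split.
    have [t [t0 [u Uu xu]]] := nbhs0_absorbing x nU.
    by exists (t + l' 0), t, 0, u; rewrite linear0 add0r.
  (* With [- x = s v], any decomposition [x = j w + t u] gives
     [- j w = (s + t) z] with [z] in [U], hence [- l w <= s + t]. *)
  have [s [s0 [v Uv xv]]] := nbhs0_absorbing (- x) nU.
  exists (- s) => _ [t [w [u [t0 Uu xu ->]]]].
  have [z Uz zE] := convex_set_conic cU s0 t0 Uv Uu.
  have st0 : 0 < s + t by exact: addr_gt0.
  have : l' ((s + t)^-1 *: - w) <= 1.
    apply: lU; rewrite linearZ linearN /=.
    have -> : - j w = (s + t) *: z by rewrite -zE -xv xu opprD addrNK.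
    by rewrite scalerA mulVf ?gt_eqF// scale1r.
  by rewrite linearZ linearN /= mulrC ler_pdivrMr// mul1r; lra.
have sp : sublinear (fun x => inf (S x)).
  apply: sublinear_inf => //.
    move=> x y _ _ [s [w [u [s0 Uu -> ->]]]] [t [z [v [t0 Uv -> ->]]]].
    have [m Um mE] := convex_set_conic cU s0 t0 Uu Uv.
    exists (s + t + l' (w + z)); last by rewrite linearD addrACA.
    by exists (s + t), (w + z), m; split;
      rewrite ?addr_gt0// linearD addrACA mE.
  move=> s x _ [t [w [u [t0 Uu -> ->]]]] s0.
  exists (s * t + l' (s *: w)); last by rewrite linearZ mulrDr.
  by exists (s * t), (s *: w), u; split;
    rewrite ?mulr_gt0// linearZ scalerDr scalerA.
have [L Llin LS] := hahn_banach sp.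
have LU u : U u -> L u <= 1.
  move=> Uu; apply: le_trans (LS u) _; apply: (ge_inf (Sinf u).2).
  by exists 1, 0, u; rewrite !linear0 add0r scale1r addr0.
have cL : continuous L by exact: scalar_bounded_continuous Llin nU LU.
have [L' LE] := scalar_linear Llin; rewrite {L Llin LU}LE in LS cL *.
have Lj w : L' (j w) <= l' w.
  apply/ler_addgt0Pl => e e0; apply: le_trans (LS (j w)) _.
  apply: (ge_inf (Sinf _).2); exists e, w, 0.
  by rewrite scaler0 addr0; split=> //; exact: nbhs_singleton.
exists L'; split=> //; first exact: linearP.
move=> w; apply/eqP; rewrite eq_le Lj/=.
by have := Lj (- w); rewrite !linearN lerN2.
Qed.

End continuous_extension.

(** * Weak topologies *)

Lemma weak_cvgP (R : realType) (E : tvsType R) (G : set_system (weak_space E))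
    (x : weak_space E) : Filter G ->
  G --> x <->
  forall l : E -> R, scalar l -> continuous l -> l @ G --> l x.
Proof.
move=> FG; split=> [Gx l /scalar_linear[f ->] fc|Gx].
  have /initial_cvgP :=
    (cvg_sup _ _ FG).1 Gx (exist _ f fc : topological_dual E).
  exact.
apply/cvg_sup => -[f fc]; apply/initial_cvgP; apply: Gx => //.
exact: linearP.
Qed.

Lemma weak_continuous (R : realType) (E : tvsType R) (l : E -> R) :
  scalar l -> continuous l -> continuous (l : weak_space E -> R).
Proof.
by move=> ll lc x; exact: (weak_cvgP x (nbhs_filter x)).1 (@cvg_id _ _) l ll lc.
Qed.

Lemma weak_nbhs (R : realType) (E : tvsType R) (x : E) (A : set E) :
  nbhs (x : weak_space E) A -> nbhs x A.
Proof.
move=> nA; have [_ xw] := @weak_cvgP R E (nbhs x) x _.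
by apply: xw nA => l _; exact.
Qed.

(** Distinct points [p] and [q] are separated by an extension of the functional
    [t z |-> t] on the line through [z = p - q], which is dominated by the gauge
    of any convex neighbourhood of 0 that avoids [z]. *)
Lemma weak_space_hausdorff (R : realType) (E : tvsType R) :
  hausdorff_space E -> hausdorff_space (weak_space E).
Proof.
move=> hE; apply: (@hausdorff_separated _ R) => p q pq.
have [//|pq0] := eqVneq p q; exfalso.
pose z : E := (p : E) - q.
have [U [cU nU Uz]] : exists U, [/\ convex_set U, nbhs (0 : E) U & ~ U z].
  have [A nA Az] : exists2 A, nbhs (0 : E) A & ~ A z.
    apply: contrapT => /forall2NP noA; case/eqP: pq0; apply/eqP.
    rewrite -subr_eq0; apply/eqP/hE => A B /nbhs_singleton Az nB.
    by exists z; split=> //; have [//|/contrapT] := noA B.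
  have [U [cU nU UA]] := convex_nbhs0 nA; exists U; split=> //.
  by move/UA.
have jlin : linear (fun t : R^o => t *: z).
  by move=> t a b; rewrite scalerDl scalerA.
pose j : {linear R^o -> E} := HB.pack (fun t : R^o => t *: z)
  (GRing.isLinear.Build R R^o E *:%R _ jlin).
have [|t Utz|L [Ll Lc Lj]] := @hahn_banach_extension R E R^o j id U _ cU nU.
- by move=> t a b.
(* If [t z] is in [U] for some [t > 1], convexity puts [z] in [U]. *)
- rewrite leNgt; apply/negP => t1; apply: Uz.
  have t10 : 0 < t - 1 by rewrite subr_gt0.
  have [w Uw] := convex_set_conic cU ltr01 t10 Utz (nbhs_singleton nU).
  rewrite scaler0 addr0 scale1r addrC subrK /= => tz.
  have t0 : t != 0 by rewrite gt_eqF// (lt_trans _ t1).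
  by rewrite (scalerI t0 tz).
have := pq L (weak_continuous Ll Lc); have := Lj 1.
have [l ->] := scalar_linear Ll.
rewrite /= scale1r linearB /= => /eqP; rewrite subr_eq => /eqP -> /eqP.
by rewrite -subr_eq0 addrK oner_eq0.
Qed.

(** * The dual of a weakly Eberlein-Grothendieck space is sigma-compact *)

Section dual_compacts.
Context {R : realType} {E : tvsType R} {K : topologicalType}.
Variable f : weak_space E -> Cp R K.
Hypothesis fE : embedding f.
Hypothesis Kc : compact [set: K].

Let ev x k : R := (f x : continuousType K R) k.

(** The basic neighbourhoods of 0 given by the embedding [f]. The single
    parameter [m] controls both the number of points and the tolerance; [k] is a
    sequence rather than an [m]-tuple in order that two slabs can be combined by
    plain concatenation of their points. *)
Definition slab (m : nat) (k : nat -> K) : set E :=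
  [set x | forall i, (i < m)%N -> `|ev x (k i) - ev 0 (k i)| < m.+1%:R^-1].

Definition polar_union (m : nat) : set {ptws E -> R} :=
  [set l | scalar (l : E -> R) /\
    exists k, forall x, slab m k x -> `|l x| <= 1].

Let ev_cvg (k : K) (x : weak_space E) : (fun y => ev y k) @ x --> ev x k.
Proof.
have [_ fc _] := fE.
have [/(_ (fc x) k) + _] := Cp_cvgP (f x) (fmap_filter f (nbhs_filter x)).
exact.
Qed.

Lemma nbhs0_slab m k : nbhs (0 : weak_space E) (slab m k).
Proof.
apply: (@filter_forall_lt _ (nbhs (0 : weak_space E))
  (fun i x => `|ev x (k i) - ev 0 (k i)| < m.+1%:R^-1)) => i _.
have /cvgrPdist_lt := @ev_cvg (k i) 0.
move=> /(_ m.+1%:R^-1); rewrite invr_gt0 ltr0n => /(_ isT).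
by apply: filterS => x /=; rewrite distrC.
Qed.

Lemma polar_union_continuous m l : polar_union m l -> continuous (l : E -> R).
Proof.
move=> [ll [k lk]].
apply: (scalar_bounded_continuous ll (weak_nbhs (nbhs0_slab m k)) (c := 1)).
by move=> x /lk; apply: le_trans; exact: ler_norm.
Qed.

(** This makes the slabs the base of a filter. *)
Lemma slab_cat m n k k' :
  exists p k'', slab p k'' `<=` slab m k `&` slab n k'.
Proof.
exists (m + n)%N, (fun i => if (i < m)%N then k i else k' (i - m)%N) => x xs.
split=> i im.
  have := xs i; rewrite im ltn_addr// => /(_ isT)/lt_le_trans; apply.
  by rewrite lef_pV2 ?posrE// ler_nat ltnS leq_addr.
have := xs (m + i)%N; rewrite ltn_add2l im ltnNge leq_addr /= addKn.
move=> /(_ isT)/lt_le_trans; apply.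
by rewrite lef_pV2 ?posrE// ler_nat ltnS leq_addl.
Qed.

(** The filter generated by the slabs converges weakly to 0, since its image
    under the embedding [f] converges pointwise. *)
Lemma dual_polar_union (k0 : K) (l : E -> R) : scalar l -> continuous l ->
  exists m, polar_union m l.
Proof.
move=> ll lc.
pose G : set_system (weak_space E) :=
  filter_from setT (fun mk : nat * (nat -> K) => slab mk.1 mk.2).
have FG : Filter G.
  apply: filter_from_filter; first by exists (0%N, fun=> k0).
  move=> [m k] [n k'] _ _; have [p [k'' sub]] := slab_cat m n k k'.
  by exists (p, k'').
have Gl : l @ G --> l 0.
  apply: (weak_cvgP (0 : weak_space E) FG).1 => //.
  apply: embedding_cvg fE _; apply/Cp_cvgP => k; apply/cvgrPdist_lt => e e0.
  have [N _ /(_ _ (leqnn N)) Ne] := near_infty_natSinv_lt (PosNum e0).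
  exists (N.+1, fun=> k) => //= x /(_ 0%N isT) /= xk; rewrite distrC.
  apply: lt_trans xk (lt_trans _ Ne).
  by rewrite ltf_pV2 ?posrE// ltr_nat.
have [g lE] := scalar_linear ll; rewrite lE in ll lc Gl *.
move/cvgrPdist_lt: Gl => /(_ 1 ltr01)[[m k] _ mk].
exists m; split=> //; exists k => x /mk /=.
by rewrite linear0 sub0r normrN => /ltW.
Qed.

(** Along an ultrafilter of functionals [l], bounded by 1 on the slab of points
    [k l], each [k l i] tends to some [c i] in [K]. A point [x] of the slab of
    [c] is then in the slab of [k l] for nearly all [l], by the strictness of
    the inequalities, and so [`|l x| <= 1] for nearly all [l]. As the slab of
    [c] is absorbing, [l x] is bounded for nearly all [l] at every [x], hence
    convergent; the limit is linear and bounded by 1 on the slab of [c]. *)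
Lemma polar_union_compact m : compact (polar_union m).
Proof.
rewrite compact_ultra => F UF FA.
have /choice[k kP] : forall l : {ptws E -> R}, exists k : nat -> K,
    polar_union m l -> forall x, slab m k x -> `|l x| <= 1.
  move=> l; have [[ll [k lk]]|nl] := pselect (polar_union m l).
    by exists k.
  by have /filter_ex[l' [_ [k _]]] := FA; exists k.
have [|c cP] := @choice nat K (fun i c => (fun l => k l i) @ F --> c).
  move=> i; have [|c _ Fc] := ultra_map_cvg (h := fun l => k l i) UF Kc.
    exact: filterT.
  by exists c.
have near_slab x : slab m c x -> F [set l : {ptws E -> R} | `|l x| <= 1].
  move=> xc.
  have FS : F [set l | slab m (k l) x].
    apply: (@filter_forall_lt _ F (fun i l =>
      `|ev x (k l i) - ev 0 (k l i)| < m.+1%:R^-1)) => i im.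
    have evc : (fun l => `|ev x (k l i) - ev 0 (k l i)|) @ F -->
        `|ev x (c i) - ev 0 (c i)|.
      apply: cvg_norm; apply: cvgB.
        by apply: (cvg_comp _ _ (cP i)); exact: cts_fun.
      by apply: (cvg_comp _ _ (cP i)); exact: cts_fun.
    have near_lt := cvgr_lt _ evc _ (xc i im).
    exact: near_lt.
  apply: filterS (filterI FA FS) => l [lA ls].
  exact: kP.
have [|L LP] := @choice E R
  (fun x a => (fun l : {ptws E -> R} => l x) @ F --> a).
  move=> x.
  have [t [t0 [u us xu]]] := nbhs0_absorbing x (weak_nbhs (nbhs0_slab m c)).
  have [|a _ Fa] := ultra_map_cvg (h := fun l : {ptws E -> R} => l x) UF
    (@segment_compact R (- t) t); last by exists a.
  apply: filterS (filterI FA (near_slab _ us)) => l [[ll _] lu] /=.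
  have [g lE] := scalar_linear ll.
  rewrite in_itv/= -ler_norml xu; move: lu; rewrite /= lE => lu.
  by rewrite linearZ /= normrM gtr0_norm// ler_piMr// ltW.
exists L; split; last by apply/ptws_cvgP.
split.
  move=> t x y.
  have near_lin : \forall l \near F,
      l (t *: x + y) = (fun l : {ptws E -> R} => t * l x + l y) l.
    by apply: filterS FA => l [ll _]; rewrite ll.
  apply: (@cvg_unique _ (@Rhausdorff R)
    ((fun l : {ptws E -> R} => t * l x + l y) @ F)) => /=.
    exact: cvg_trans (near_eq_cvg near_lin) (LP (t *: x + y)).
  by apply: cvgD (LP y); apply: cvgM (LP x); exact: cvg_cst.
exists c => x /near_slab Fx.
have Lx1 : (fun l : {ptws E -> R} => `|l x|) @ F --> `|L x|.
  by apply: cvg_norm; exact: LP.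
have one : (fun l : {ptws E -> R} => 1 : R) @ F --> (1 : R) by exact: cvg_cst.
exact: (ler_cvg_to Lx1 one Fx).
Qed.

End dual_compacts.

(** When [K] is empty there is no sequence of points of [K] to define slabs
    with; but then [C_p(K)], and hence [E], is a single point. *)
Theorem dual_sigma_compact (R : realType) (E : tvsType R) :
  eberlein_grothendieck R (weak_space E) ->
  exists A : nat -> set {ptws E -> R},
    [/\ forall n, compact (A n),
        forall n l, A n l -> scalar (l : E -> R) /\ continuous (l : E -> R) &
        forall l : E -> R, scalar l -> continuous l -> exists n, A n l].
Proof.
move=> [K [hK Kc [f fE]]].
have [[k0 _]|K0] := pselect (exists k : K, True); last first.
  have E0 (x : E) : x = 0.
    case: fE => finj _ _; apply: finj.
    by apply/continuousEP => k; case: K0; exists k.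
  exists (fun=> [set (fun=> 0) : {ptws E -> R}]); split.
  - by move=> _; exact: compact_set1.
  - move=> _ l ->; split=> [t x y|]; first by rewrite mulr0 addr0.
    by move=> x; exact: cvg_cst.
  - move=> l /scalar_linear[g ->] _; exists 0%N; apply/funext => x.
    by rewrite (E0 x) linear0.
exists (polar_union f); split.
- by move=> n; exact: polar_union_compact.
- by move=> n l nl; split; [case: nl|exact: polar_union_continuous nl].
- exact: dual_polar_union k0.
Qed.

(** * Quotients, subspaces and products *)

Section precomposition.
Context {R : realType} {Y Z : Type} (p : Y -> Z).

Definition precomp (l : {ptws Z -> R}) : {ptws Y -> R} := l \o p.

Lemma precomp_continuous : continuous precomp.
Proof.
by apply: ptws_continuous => y l; exact: (@ptws_eval_continuous R Z (p y)).
Qed.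

(** [precomp p] is a closed embedding when [p] is onto: a limit of functions
    constant on the fibers of [p] is constant on them too, and convergence of
    [l \o p] at a preimage [s z] of [z] is convergence of [l] at [z]. *)
Lemma compact_precomp_preimage (A : set {ptws Y -> R}) :
  range p = [set: Z] -> compact A -> compact (precomp @^-1` A).
Proof.
move=> psurj Ac; rewrite compact_ultra => F UF FA.
have [g Ag Fg] := ultra_map_cvg UF Ac FA.
have FF : Filter F by exact: filter_filter.
have [/(_ Fg) gcvg _] := ptws_cvgP g (fmap_filter precomp FF).
have /choice[s ps] : forall z, exists y, p y = z.
  by move=> z; have [y _ <-] : range p z by [rewrite psurj]; exists y.
have sE z : (fun l : {ptws Z -> R} => l z) =
    (fun h : {ptws Y -> R} => h (s z)) \o precomp.
  by apply/funext => l; rewrite /precomp /= ps.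
have gE : precomp (g \o s) = g.
  apply/funext => y; apply: (@cvg_unique _ (@Rhausdorff R)
    ((fun l : {ptws Z -> R} => l (p y)) @ F)) => /=; last exact: gcvg y.
  by rewrite sE; exact: gcvg.
exists (g \o s); split; first by rewrite /= gE.
have [_ gs] := ptws_cvgP (g \o s : {ptws Z -> R}) FF; apply: gs => z.
by rewrite sE; exact: gcvg.
Qed.

End precomposition.

Section weak_space_criterion.
Context {R : realType} {E : tvsType R}.

(** The condition on the sets [A n] is about convergence because, for products,
    the natural compact sets span the dual without exhausting it. *)
Lemma weak_eberlein_grothendieck (A : nat -> set {ptws E -> R}) :
  hausdorff_space E -> (forall n, compact (A n)) ->
  (forall n l, A n l -> scalar (l : E -> R) /\ continuous (l : E -> R)) ->
  (forall (G : set_system E) (x : E), Filter G ->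
    (forall n l, A n l -> l @ G --> l x) ->
    forall l : E -> R, scalar l -> continuous l -> l @ G --> l x) ->
  eberlein_grothendieck R (weak_space E).
Proof.
move=> hE Ac Adual Agen.
apply: (@eberlein_grothendieck_of_compacts R (weak_space E) A) => //.
- exact: weak_space_hausdorff.
- by move=> n l /Adual[ll lc]; exact: weak_continuous.
- by move=> G x FG Gx; apply/weak_cvgP; exact: Agen.
Qed.

Lemma weak_eberlein_grothendieck_dual (A : nat -> set {ptws E -> R}) :
  hausdorff_space E -> (forall n, compact (A n)) ->
  (forall n l, A n l -> scalar (l : E -> R) /\ continuous (l : E -> R)) ->
  (forall l : E -> R, scalar l -> continuous l -> exists n, A n l) ->
  eberlein_grothendieck R (weak_space E).
Proof.
move=> hE Ac Adual dualA.
apply: (weak_eberlein_grothendieck hE Ac Adual) => G x _ Gx l ll lc.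
by have [n Al] := dualA l ll lc; exact: Gx Al.
Qed.

End weak_space_criterion.

(** A functional [l] on [F] with [l \o pi] continuous is continuous because
    [pi] is open: the preimage of [V] by [l] is the image by [pi] of the
    preimage of [V] by [l \o pi]. *)
Lemma weak_quotient (R : realType) (E F : tvsType R) (pi : {linear E -> F}) :
  hausdorff_space F -> linear_quotient_map pi ->
  eberlein_grothendieck R (weak_space E) ->
  eberlein_grothendieck R (weak_space F).
Proof.
move=> hF [pic piop pisurj] /dual_sigma_compact[A [Ac Adual dualA]].
apply: (@weak_eberlein_grothendieck_dual R F (fun n => precomp pi @^-1` A n)).
- by [].
- by move=> n; exact: compact_precomp_preimage.
- move=> n l /Adual[ll lc]; split.
    move=> t y z.
    have [u _ <-] : range pi y by rewrite pisurj.
    have [v _ <-] : range pi z by rewrite pisurj.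
    by rewrite -(linearP pi); exact: ll.
  apply/continuousP => V oV.
  have -> : l @^-1` V = pi @` ((l \o pi) @^-1` V).
    rewrite eqEsubset; split=> [y Vy|_ [x Vx <-]//].
    have [u _ uy] : range pi y by rewrite pisurj.
    by exists u; rewrite //= uy.
  by apply: piop; move: V oV; apply/continuousP.
- move=> l ll lc; apply: dualA.
    by move=> t x y; rewrite -ll -(linearP pi).
  by move=> x; apply: continuous_comp; [exact: pic|exact: lc].
Qed.

Lemma hausdorff_injective (X Y : topologicalType) (h : X -> Y) :
  injective h -> continuous h -> hausdorff_space Y -> hausdorff_space X.
Proof.
move=> hinj hc hY p q; rewrite cluster_cvgE => -[G PG [Gq Gp]].
apply: hinj; apply: (@cvg_unique _ hY (h @ G)).
  exact: (cvg_comp _ _ Gp (hc p)).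
exact: (cvg_comp _ _ Gq (hc q)).
Qed.

(** [l < 1] on the trace of some neighbourhood of 0 of [E], inside which a
    convex one is found. *)
Lemma dual_extension (R : realType) (E : tvsType R) (F : submodClosed E)
    (l : linear_subspace F -> R) :
  scalar l -> continuous l ->
  exists L : E -> R,
    [/\ scalar L, continuous L & forall y : linear_subspace F, L (val y) = l y].
Proof.
move=> ll lc.
have l0 : l 0 = 0 by have [g ->] := scalar_linear ll; rewrite linear0.
have : nbhs (0 : linear_subspace F) [set y | l y < 1].
  by apply: (cvgr_lt _ (lc 0)); rewrite l0.
case=> _ [[B oB <-] B0] Bl.
have [U [cU nU UB]] : exists U, [/\ convex_set U, nbhs (0 : E) U & U `<=` B].
  by apply: convex_nbhs0; exact: open_nbhs_nbhs.
apply: (@hahn_banach_extension R E (linear_subspace F) \val l U) => //.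
by move=> w /UB Bw; apply/ltW/Bl.
Qed.

Lemma weak_subspace (R : realType) (E : tvsType R) (F : submodClosed E) :
  hausdorff_space E -> eberlein_grothendieck R (weak_space E) ->
  eberlein_grothendieck R (weak_space (linear_subspace F)).
Proof.
move=> hE /dual_sigma_compact[A [Ac Adual dualA]].
have valc : continuous (\val : linear_subspace F -> E).
  exact: (@initial_continuous (linear_subspace F) E \val).
apply: (@weak_eberlein_grothendieck_dual R (linear_subspace F)
  (fun n => precomp \val @` A n)).
- exact: (@hausdorff_injective (linear_subspace F) E \val val_inj valc hE).
- move=> n; apply: continuous_compact (Ac n); apply: continuous_subspaceT.
  exact: precomp_continuous.
- move=> n _ [l /Adual[ll lc] <-]; split.
    by move=> t x y; rewrite /precomp /= -ll.
  by move=> x; apply: continuous_comp; [exact: valc|exact: lc].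
- move=> l ll lc; have [L [Ll Lc Ly]] := dual_extension ll lc.
  have [n AL] := dualA L Ll Lc; exists n, L => //.
  by apply/funext => y; exact: Ly.
Qed.

Section product_dual.
Context {R : realType} {E : nat -> tvsType R}.
Local Notation V := (prod_topology E).
Implicit Types (x : V) (l : V -> R).

Lemma coord_comp_continuous i (g : E i -> R) :
  continuous g -> continuous (fun x : V => g (x i)).
Proof.
move=> gc x; exact: (@cvg_comp _ _ _ (fun z : V => z i) g _ _ _
  (@proj_continuous nat E i x) (gc (x i))).
Qed.

(** Otherwise, for every [N], some [x N] whose first [N] coordinates vanish has
    [l (x N) = 1]; yet the sequence [x] tends to 0 coordinatewise. *)
Lemma dual_prod_finite l : scalar l -> continuous l ->
  exists N, forall x, (forall i, (i < N)%N -> x i = 0) -> l x = 0.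
Proof.
move=> /scalar_linear[g ->] gc; apply: contrapT => /forallNP nN.
have /choice[x xP] : forall N, exists x : V,
    (forall i, (i < N)%N -> x i = 0) /\ g x = 1.
  move=> N; have /existsNP[x /not_implyP[x0 /eqP gx]] := nN N.
  exists ((g x)^-1 *: x); split; last by rewrite linearZ /= mulVf.
  by move=> i /x0 xi; rewrite -[LHS]/((g x)^-1 *: x i) xi scaler0.
have x0 : x @ \oo --> (0 : V).
  apply/cvg_sup => i; apply/initial_cvgP.
  apply: (cvg_trans (near_eq_cvg _) (cvg_cst (0 : E i))).
  by exists i.+1 => // N /= iN; rewrite (xP N).1.
have : (fun N => g (x N)) @ \oo --> (0 : R).
  by rewrite -[X in _ --> X](linear0 g); exact: cvg_comp x0 (gc 0).
rewrite (_ : (fun N => g (x N)) = fun=> 1); last first.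
  by apply/funext => N; exact: (xP N).2.
move=> /(cvg_unique (@Rhausdorff R))/(_ (cvg_cst _)) /eqP.
by rewrite eq_sym oner_eq0.
Qed.

Definition prod_inj (i : nat) (v : E i) : V := dfwith (0 : V) i v.

Lemma prod_injE i (v : E i) : prod_inj v i = v.
Proof. exact: dfwithin. Qed.

Lemma prod_inj_out i j (v : E i) : i != j -> prod_inj v j = 0.
Proof. by move=> ij; rewrite /prod_inj dfwithout. Qed.

Lemma prod_inj_linear i : linear (@prod_inj i).
Proof.
move=> t u v; apply: functional_extensionality_dep => j.
have [<-|ij] := eqVneq i j.
  by rewrite -[RHS]/(t *: prod_inj u i + prod_inj v i) !prod_injE.
rewrite -[RHS]/(t *: prod_inj u j + prod_inj v j) !prod_inj_out//.
by rewrite scaler0 addr0.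
Qed.

Lemma prod_inj_continuous i : continuous (@prod_inj i).
Proof. exact: dfwith_continuous. Qed.

(** Induction on the number of coordinates on which [l] depends: the
    contribution of the last one, [y |-> l (prod_inj (y N))], is a functional of
    the factor [E N], and the rest of [l] depends on one coordinate fewer. *)
Lemma dual_prod_cvg (G : set_system V) x : Filter G ->
  (forall i (g : E i -> R), scalar g -> continuous g ->
    (fun y : V => g (y i)) @ G --> g (x i)) ->
  forall l, scalar l -> continuous l -> l @ G --> l x.
Proof.
move=> FG Gx l ll lc; have [N] := dual_prod_finite ll lc.
elim: N l ll lc => [|N IH] l ll lc l0.
  have -> : l = fun=> 0 by apply/funext => y; exact: l0.
  exact: cvg_cst.
have [h lE] := scalar_linear ll.
pose g (v : E N) := l (prod_inj v).
have gl : scalar g by move=> t u v; rewrite /g prod_inj_linear ll.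
have gc : continuous g.
  move=> v; exact: (@cvg_comp _ _ _ (@prod_inj N) l _ _ _
    (@prod_inj_continuous N v) (lc (prod_inj v))).
have lgE y : l y = (l y - g (y N)) + g (y N) by rewrite subrK.
have -> : l = fun y => (l y - g (y N)) + g (y N) by apply/funext.
apply: cvgD; last exact: Gx.
apply: (IH (fun y => l y - g (y N))).
- move=> t u v; rewrite -[(t *: u + v) N]/(t *: u N + v N) ll gl.
  by rewrite /= mulrBr opprD addrACA.
- have lgc : continuous (l - (fun z : V => g (z N))).
    by move=> y; apply: continuousB; [exact: lc|exact: coord_comp_continuous].
  exact: lgc.
- move=> y y0; rewrite /g lE -linearB /= -lE; apply: l0 => i.
  rewrite -[(y - _) i]/(y i - prod_inj (y N) i).
  rewrite ltnS leq_eqVlt => /predU1P[->|iN]; first by rewrite prod_injE subrr.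
  by rewrite y0// prod_inj_out ?subrr// gtn_eqF.
Qed.

End product_dual.

Lemma weak_product (R : realType) (E : nat -> tvsType R) :
  (forall n, hausdorff_space (E n)) ->
  (forall n, eberlein_grothendieck R (weak_space (E n))) ->
  eberlein_grothendieck R (weak_space (prod_topology E)).
Proof.
move=> hE egE.
have [A AP] : {A : forall n, nat -> set {ptws E n -> R} & forall n,
    [/\ forall m, compact (A n m),
        forall m l, A n m l ->
          scalar (l : E n -> R) /\ continuous (l : E n -> R) &
        forall l : E n -> R, scalar l -> continuous l -> exists m, A n m l]}.
  exists (fun n => sval (cid (dual_sigma_compact (egE n)))) => n.
  exact: svalP (cid (dual_sigma_compact (egE n))).
pose coord i (x : prod_topology E) : E i := x i.
pose B n : set {ptws prod_topology E -> R} :=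
  if unpickle n is Some (i, m) then precomp (coord i) @` A i m else set0.
apply: (@weak_eberlein_grothendieck R (prod_topology E) B).
- exact: hausdorff_product.
- move=> n; rewrite /B; case: unpickle => [[i m]|]; last exact: compact0.
  have [Ac _ _] := AP i.
  apply: continuous_compact (Ac m); apply: continuous_subspaceT.
  exact: precomp_continuous.
- move=> n l; rewrite /B; case: unpickle => [[i m]|//] [g Ag <-].
  have [_ /(_ _ _ Ag)[gl gc] _] := AP i; split; last first.
    exact: coord_comp_continuous.
  by move=> t x y; rewrite /precomp /= -gl.
- move=> G x FG Gx; apply: dual_prod_cvg => i g gl gc.
  have [_ _ /(_ g gl gc)[m Ag]] := AP i.
  apply: (Gx (pickle (i, m)) (precomp (coord i) g)).
  by rewrite /B pickleK; exists g.
Qed.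

Theorem proposition2p4 (R : realType) :
  [/\ forall (E F : tvsType R) (pi : {linear E -> F}),
        hausdorff_space E -> hausdorff_space F ->
        eberlein_grothendieck R (weak_space E) ->
        linear_quotient_map pi ->
        eberlein_grothendieck R (weak_space F),
      forall (E : tvsType R) (F : submodClosed E),
        hausdorff_space E ->
        eberlein_grothendieck R (weak_space E) ->
        eberlein_grothendieck R (weak_space (linear_subspace F)) &
      forall E : nat -> tvsType R,
        (forall n, hausdorff_space (E n)) ->
        (forall n, eberlein_grothendieck R (weak_space (E n))) ->
        eberlein_grothendieck R (weak_space (prod_topology E))].
Proof.
split.
- by move=> E F pi _ hF egE quo; exact: weak_quotient hF quo egE.
- exact: weak_subspace.
- exact: weak_product.
Qed.
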